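(* Let $F$ be a field with $\operatorname{char} F\ne 2$, and let $R$ be a Rota--Baxter operator of weight zero on the superalgebra $\mathrm{K}_3$ over $F$. Then, up to conjugation by an automorphism of $\mathrm{K}_3$ (i.e. after replacing $R$ by $\psi^{-1}R\psi$ for some $\psi\in\mathrm{Aut}(\mathrm{K}_3)$), one has $R(e)=R(x)=0$ and $R(y)=ae+bx$ for some $a,b\in F$.
   Context: $\mathrm{K}_3=A_0\oplus A_1$ is the three-dimensional simple Jordan (Kaplansky) superalgebra with even part $A_0=\mathrm{span}\{e\}$, odd part $A_1=\mathrm{span}\{x,y\}$ and product $e^2=e$, $ex=xe=\frac{x}{2}$, $ey=ye=\frac{y}{2}$, $xy=-yx=\frac{e}{2}$, $x^2=y^2=0$. A linear operator $R\colon A\to A$ (not assumed to preserve any grading) on an algebra $A$ is a Rota--Baxter operator of weight zero if $R(u)R(v)=R(R(u)v+uR(v))$ for all $u,v\in A$. *)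

(* Defs.v *)
From mathcomp Require Import all_boot all_algebra ring.

Set Implicit Arguments.
Unset Strict Implicit.
Unset Printing Implicit Defensive.

Import GRing.Theory.
Local Open Scope ring_scope.

Definition rota_baxter0 (F : fieldType) (A : vectType F) (mul : A -> A -> A)
    (R : 'End(A)) : Prop :=
  forall u v : A, mul (R u) (R v) = R (mul (R u) v + mul u (R v)).

(* (alpha, beta, gamma) stands for alpha e + beta x + gamma y *)
Notation K3 F := 'rV[F]_3.

Definition K3e (F : fieldType) : K3 F := delta_mx 0 0.
Definition K3x (F : fieldType) : K3 F := delta_mx 0 1.
Definition K3y (F : fieldType) : K3 F := delta_mx 0 2.
Arguments K3e {F}.
Arguments K3x {F}.
Arguments K3y {F}.

Definition K3table (F : fieldType) (i j : 'I_3) : K3 F :=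
  match val i, val j with
  | 0, 0 => K3e
  | 0, 1 | 1, 0 => 2^-1 *: K3x
  | 0, 2 | 2, 0 => 2^-1 *: K3y
  | 1, 2 => 2^-1 *: K3e
  | 2, 1 => - (2^-1 *: K3e)
  | _, _ => 0%R
  end%N.

Definition K3mul (F : fieldType) (u v : K3 F) : K3 F :=
  \sum_(i < 3) \sum_(j < 3) (u 0 i * v 0 j) *: K3table F i j.

Definition K3even (F : fieldType) : {vspace K3 F} := <[K3e]>%VS.
Definition K3odd (F : fieldType) : {vspace K3 F} := (<[K3x]> + <[K3y]>)%VS.

(* Automorphisms of a superalgebra preserve the parity; for K_3 in
   characteristic different from 2 this follows from the first two clauses,
   see K3alg_aut_even below. *)
Definition K3automorphism (F : fieldType) (psi : 'End(K3 F)) : Prop :=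
  [/\ bijective psi,
      {morph psi : u v / K3mul u v},
      (psi @: K3even F <= K3even F)%VS
    & (psi @: K3odd F <= K3odd F)%VS].

Definition K3vec (F : fieldType) (a b c : F) : K3 F :=
  a *: K3e + b *: K3x + c *: K3y.

Lemma K3vecP (F : fieldType) (u : K3 F) : u = K3vec (u 0 0) (u 0 1) (u 0 2).
Proof.
apply/rowP => i; rewrite !mxE /=.
by case: i => [[|[|[|//]]] lti] /=; rewrite ?(mulr0, mulr1, addr0, add0r);
  congr (u _ _); apply: val_inj.
Qed.

Lemma K3vec_inj (F : fieldType) (a b c a' b' c' : F) :
  K3vec a b c = K3vec a' b' c' -> [/\ a = a', b = b' & c = c'].
Proof.
move=> /rowP eq_u; split; [have := eq_u 0 | have := eq_u 1 | have := eq_u 2];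
  by rewrite !mxE /= ?(mulr0, mulr1, addr0, add0r).
Qed.

Lemma K3vecZ (F : fieldType) (k a b c : F) :
  k *: K3vec a b c = K3vec (k * a) (k * b) (k * c).
Proof. by rewrite /K3vec !scalerDr !scalerA. Qed.

Lemma K3vec_basis (F : fieldType) :
  [/\ K3e = K3vec 1 0 0 :> K3 F, K3x = K3vec 0 1 0 :> K3 F
    & K3y = K3vec 0 0 1 :> K3 F].
Proof. by split; rewrite /K3vec !scale0r scale1r ?addr0 ?add0r. Qed.

Lemma K3mulE (F : fieldType) (a b c a' b' c' : F) :
  K3mul (K3vec a b c) (K3vec a' b' c') =
  K3vec (a * a' + 2^-1 * (b * c' - c * b')) (2^-1 * (a * b' + b * a'))
        (2^-1 * (a * c' + c * a')).
Proof.
rewrite /K3mul !big_ord_recl !big_ord0 /K3table /=.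
apply/rowP => i; rewrite !mxE /=.
by case: i => [[|[|[|//]]] lti] /=; ring.
Qed.

Lemma K3alg_aut_even (F : fieldType) (psi : 'End(K3 F)) :
  2 \notin [pchar F] -> bijective psi -> {morph psi : u v / K3mul u v} ->
  (psi @: K3even F <= K3even F)%VS /\ (psi @: K3odd F <= K3odd F)%VS.
Proof.
move=> char_neq2 /bij_inj psi_inj psiM.
have n2 : 2 != 0 :> F by move: char_neq2; rewrite inE /=.
have [eE xE yE] := K3vec_basis F.
have psie0 : psi K3e != 0.
  rewrite -(linear0 psi) (inj_eq psi_inj); apply/eqP => /rowP/(_ 0).
  by rewrite !mxE /= => /eqP; rewrite oner_eq0.
have [a [b [c pe]]] : exists a b c, psi K3e = K3vec a b c.
  by do 3!eexists; apply: K3vecP.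
have a1 : a = 1.
  have ee : K3mul K3e K3e = K3e :> K3 F.
    by rewrite eE K3mulE; congr K3vec; ring.
  move: (psiM K3e K3e); rewrite ee pe K3mulE => /K3vec_inj[ea eb ec].
  have eb' : b = a * b.
    by rewrite [LHS]eb; field.
  have ec' : c = a * c.
    by rewrite [LHS]ec; field.
  have ea' : a * (a - 1) = 0.
    by apply/eqP; rewrite mulrBr mulr1 subr_eq0 [eqbRHS]ea; apply/eqP; ring.
  move/eqP: ea'; rewrite mulf_eq0 => /orP[/eqP a0|]; last first.
    by rewrite subr_eq0 => /eqP.
  move: psie0; rewrite pe eb' ec' a0 !mul0r /K3vec !scale0r !addr0.
  by rewrite eqxx.
have odd_img q r : exists q' r', psi (K3vec 0 q r) = K3vec 0 q' r'.
  have [p [q' [r' pw]]] : exists p q' r', psi (K3vec 0 q r) = K3vec p q' r'.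
    by do 3!eexists; apply: K3vecP.
  exists q', r'; rewrite pw.
  have ew : K3mul K3e (K3vec 0 q r) + K3mul (K3vec 0 q r) K3e = K3vec 0 q r.
    rewrite eE !K3mulE /K3vec; apply/rowP => i; rewrite !mxE /=.
    by case: i => [[|[|[|//]]] lti] /=; field.
  have := congr1 psi ew; rewrite linearD /= !psiM pe pw a1 !K3mulE.
  move=> /rowP/(_ 0); rewrite !mxE /= => ep.
  suff -> : p = 0 by [].
  have -> : p = (p + p) - p by ring.
  apply/eqP; rewrite subr_eq0; apply/eqP; move: ep.
  by rewrite ?(mulr0, mulr1, addr0, add0r) => ep; rewrite -[RHS]ep; ring.
split.
  apply/subvP => _ /memv_imgP[_ /vlineP[k ->] ->].
  rewrite linearZ memvZ //; apply/vlineP; exists 1; rewrite scale1r.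
  have [q [r px]] := odd_img 1 0; have [q' [r' py]] := odd_img 0 1.
  have exy : K3e = 2 *: K3mul (K3vec 0 1 0) (K3vec 0 0 1) :> K3 F.
    by rewrite K3mulE K3vecZ eE; congr K3vec; field.
  have := congr1 psi exy; rewrite linearZ /= psiM px py pe K3mulE K3vecZ.
  by rewrite a1 eE => /K3vec_inj[_ -> ->]; congr K3vec; ring.
apply/subvP => _ /memv_imgP[_ /memv_addP[_ /vlineP[q ->] [_ /vlineP[r ->] ->]] ->].
have [q' [r' e']] := odd_img q r.
move: e'; rewrite /K3vec !scale0r !add0r => ->.
by apply: memv_add; apply/vlineP; eexists.
Qed.

(* Main.v *)
(** Write R(e) = p e + w with w odd.  Subtracting the Rota-Baxter identities for
    (e, v) and (v, e), v odd, leaves <w, T v> e = <w, v> R(e), where T v is the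
    odd part of R(v) and <,> the symplectic form on A_1; this forces w = 0, and
    the identity for (e, e) then gives p = 0.  With R(e) = 0 the identity for
    (e, v) becomes R(T v) = 0, so R kills some nonzero odd vector x' and T is
    nilpotent.  The automorphism group acts on A_1 as SL_2, hence x' can be
    moved to x. *)
Require Import Defs.
From mathcomp Require Import all_boot all_algebra.
From mathcomp Require Import ring.

Set Implicit Arguments.
Unset Strict Implicit.
Unset Printing Implicit Defensive.

Import GRing.Theory.
Local Open Scope ring_scope.

Lemma K3vecD (F : fieldType) (a b c a' b' c' : F) :
  K3vec a b c + K3vec a' b' c' = K3vec (a + a') (b + b') (c + c').
Proof. by rewrite /K3vec !scalerDl [LHS]addrACA; congr (_ + _); rewrite addrACA. Qed.

Lemma K3vec0 (F : fieldType) : K3vec 0 0 0 = 0 :> K3 F.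
Proof. by rewrite /K3vec !scale0r !addr0. Qed.

Lemma K3vec_ex (F : fieldType) (u : K3 F) : exists a b c, u = K3vec a b c.
Proof. by exists (u 0 0), (u 0 1), (u 0 2); apply: K3vecP. Qed.

Section RotaBaxter.

Variables (F : fieldType) (R : 'End(K3 F)).
Hypotheses (n2 : 2 != 0 :> F) (R_rb : rota_baxter0 (@K3mul F) R).

(** In the difference of the two identities every product involving [e] cancels by commutativity.
    Products of odd elements anticommute and so double, which absorbs the factor 1/2 in
    [xy = e/2]. *)
Lemma rota_baxter_K3e_odd (p q r b c l s t : F) :
    R K3e = K3vec p q r -> R (K3vec 0 b c) = K3vec l s t ->
  K3vec (q * t - r * s) 0 0 = (q * c - r * b) *: R K3e.
Proof.
move=> Re Rv; have [eE _ _] := K3vec_basis F.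
have := R_rb K3e (K3vec 0 b c); have := R_rb (K3vec 0 b c) K3e.
rewrite Re Rv eE !K3mulE !K3vecD => h1 h2.
have := congr2 (fun u v => u - v) h2 h1.
rewrite -linearB /= -!scaleN1r !K3vecZ !K3vecD.
set u := K3vec _ _ _; set v := K3vec _ _ _ => uv.
transitivity u; first by rewrite /u; congr K3vec; field.
rewrite uv -K3vecZ -Re -linearZ /= eE K3vecZ; congr (R _).
by rewrite /v; congr K3vec; field.
Qed.

Lemma rota_baxter_K3e : R K3e = 0.
Proof.
have [eE _ _] := K3vec_basis F.
have [p [q [r Re]]] := K3vec_ex (R K3e).
have [l1 [s1 [t1 Rx]]] := K3vec_ex (R (K3vec 0 1 0)).
have [l2 [s2 [t2 Ry]]] := K3vec_ex (R (K3vec 0 0 1)).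
(* For v = y the x-coordinate reads 0 = q^2; below, for v = x, the y-coordinate reads 0 = -r^2. *)
have := rota_baxter_K3e_odd Re Ry; rewrite Re K3vecZ => /K3vec_inj[_ /esym/eqP].
rewrite mulr0 mulr1 subr0 mulf_eq0 orbb => /eqP q0 _.
have := rota_baxter_K3e_odd Re Rx; rewrite Re K3vecZ => /K3vec_inj[_ _ /esym/eqP].
rewrite mulr0 mulr1 sub0r mulNr oppr_eq0 mulf_eq0 orbb => /eqP r0.
(* Now R(e) = p e, and the identity for (e, e) reads p^2 = 2 p^2. *)
have := R_rb K3e K3e; rewrite Re q0 r0 {1 2}eE !K3mulE K3vecD.
set v := K3vec (_ + _) _ _.
have -> : v = (2 * p) *: K3e by rewrite /v eE K3vecZ; congr K3vec; ring.
rewrite linearZ /= Re q0 r0 K3vecZ => /K3vec_inj[pp _ _].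
have /eqP : p * p = 0.
  have := congr1 (fun z => z - p * p) pp.
  by rewrite mulr0 subrr mulr0 addr0 subrr => {1}->; ring.
by rewrite mulf_eq0 orbb => /eqP->; rewrite K3vec0.
Qed.

Lemma rota_baxter_K3odd (b c l s t : F) :
  R (K3vec 0 b c) = K3vec l s t -> R (K3vec 0 s t) = 0.
Proof.
move=> Rv; have [eE _ _] := K3vec_basis F.
have Re := rota_baxter_K3e.
have := R_rb K3e (K3vec 0 b c); rewrite Re Rv -K3vec0 eE !K3mulE K3vecD.
set v := K3vec (_ + _) _ _; set u := K3vec (_ + _) _ _ => uv.
have u0 : u = 0 by rewrite -K3vec0 /u; congr K3vec; ring.
(* Since R(e) = 0, the argument [v] of R is e R(v) = l e + (s x + t y)/2, and R kills its e-part. *)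
have vE : K3vec 0 s t = 2 *: (v - l *: K3e).
  by rewrite /v eE -scaleN1r !K3vecZ K3vecD K3vecZ; congr K3vec; field.
by rewrite vE linearZ linearB linearZ /= Re -uv u0 scaler0 subr0 scaler0 K3vec0.
Qed.

(** If T is nonzero, then T x or T y is a nonzero odd vector killed by R. If T = 0, then R maps the
    plane A_1 into the line F e and so has a kernel there. *)
Lemma rota_baxter_K3odd_ker :
  exists q r : F, (q, r) != (0, 0) /\ R (K3vec 0 q r) = 0.
Proof.
have [l1 [s1 [t1 Rx]]] := K3vec_ex (R (K3vec 0 1 0)).
have [l2 [s2 [t2 Ry]]] := K3vec_ex (R (K3vec 0 0 1)).
have [st1|] := eqVneq (s1, t1) (0, 0); last first.
  by exists s1, t1; split=> //; apply: rota_baxter_K3odd Rx.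
have [st2|] := eqVneq (s2, t2) (0, 0); last first.
  by exists s2, t2; split=> //; apply: rota_baxter_K3odd Ry.
case: st1 st2 Rx Ry => -> -> [-> ->] Rx Ry.
(* Here R(x) = l1 e and R(y) = l2 e, so l2 x - l1 y is killed; if it vanishes, x itself is
   killed. *)
have [ll|] := eqVneq (l2, - l1) (0, 0); last first.
  exists l2, (- l1); split=> //.
  have -> : K3vec 0 l2 (- l1) = l2 *: K3vec 0 1 0 - l1 *: K3vec 0 0 1.
    by rewrite -scaleNr !K3vecZ K3vecD; congr K3vec; ring.
  rewrite linearB !linearZ /= Rx Ry -scaleN1r !K3vecZ K3vecD -K3vec0.
  by congr K3vec; ring.
exists 1, 0; split; first by rewrite xpair_eqE oner_eq0.
by case: ll => _ /eqP; rewrite oppr_eq0 Rx => /eqP->; rewrite K3vec0.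
Qed.

End RotaBaxter.

(** The matrix acts on row vectors from the right, so its rows are the images of e, x, y. *)
Definition K3odd_lin (F : fieldType) (q r q' r' : F) : 'End(K3 F) :=
  linfun (mulmxr (\matrix_(i < 3)
    nth 0 [:: K3e; K3vec 0 q r; K3vec 0 q' r'] i) : K3 F -> K3 F).

Lemma K3odd_linE (F : fieldType) (q r q' r' a b c : F) :
  K3odd_lin q r q' r' (K3vec a b c) =
  K3vec a (b * q + c * q') (b * r + c * r').
Proof.
have [eE xE yE] := K3vec_basis F.
rewrite lfunE /= {1}/K3vec !mulmxDl -!scalemxAl -!rowE !rowK /=.
by rewrite eE !K3vecZ !K3vecD; congr K3vec; ring.
Qed.

(** Determinant 1 means that the symplectic form giving the product of odd elements is preserved. *)
Lemma K3odd_lin_automorphism (F : fieldType) (q r q' r' : F) :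
    2 \notin [pchar F] -> q * r' - r * q' = 1 ->
  K3automorphism (K3odd_lin q r q' r').
Proof.
move=> char_neq2 det1; have detE : r * q' = q * r' - 1 by rewrite -det1; ring.
have psi_bij : bijective (K3odd_lin q r q' r').
  (* The inverse comes from the adjugate 2 x 2 matrix. *)
  exists (K3odd_lin r' (- r) (- q') q) => u; have [a [b [c ->]]] := K3vec_ex u;
    by rewrite !K3odd_linE; congr K3vec; ring: detE.
have psiM : {morph K3odd_lin q r q' r' : u v / K3mul u v}.
  move=> u v; have [a [b [c ->]]] := K3vec_ex u.
  have [a' [b' [c' ->]]] := K3vec_ex v.
  by rewrite K3mulE !K3odd_linE K3mulE; congr K3vec; ring: detE.
by have [] := K3alg_aut_even char_neq2 psi_bij psiM.
Qed.

Theorem proposition2 (F : fieldType) (char_neq2 : 2%N \notin [pchar F])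
    (R : 'End(K3 F)) (R_rb : rota_baxter0 (@K3mul F) R) :
  exists psi : 'End(K3 F), K3automorphism psi /\
    let R' : 'End(K3 F) := (psi^-1 \o R \o psi)%VF in
    [/\ R' K3e = 0, R' K3x = 0
      & exists a b : F, R' K3y = a *: K3e + b *: K3x].
Proof.
have n2 : 2 != 0 :> F by move: char_neq2; rewrite inE /=.
have [eE xE yE] := K3vec_basis F.
have [q [r [qr0 Rx']]] := rota_baxter_K3odd_ker n2 R_rb.
(* The killed vector x' = q x + r y is completed to a matrix in SL_2, so that [psi] sends x to
   x'. *)
have [q' [r' det1]] : exists q' r', q * r' - r * q' = 1.
  have [q0|q0] := eqVneq q 0; last by exists 0, q^-1; field.
  have r0 : r != 0 by move: qr0; rewrite q0 xpair_eqE eqxx.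
  by exists (- r^-1), 0; field.
have psi_aut := K3odd_lin_automorphism char_neq2 det1.
set psi := K3odd_lin q r q' r' in psi_aut *.
exists psi; split=> //; have [/bij_inj psi_inj _ _ _] := psi_aut.
have psiK : cancel psi (psi^-1)%VF by apply/lker0_lfunK/lker0P.
rewrite /= !comp_lfunE /=.
have -> : psi K3e = K3e.
  by rewrite eE K3odd_linE; congr K3vec; ring.
have -> : psi K3x = K3vec 0 q r.
  by rewrite xE K3odd_linE; congr K3vec; ring.
rewrite (rota_baxter_K3e n2 R_rb) Rx' linear0; split=> //.
have psiy : psi K3y = K3vec 0 q' r'.
  by rewrite yE K3odd_linE; congr K3vec; ring.
have [u Ru] : exists u, R (psi K3y) = psi u.
  have [[g _ gK] _ _ _] := psi_aut; by exists (g (R (psi K3y))).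
rewrite Ru psiK; have [a [b [c uE]]] := K3vec_ex u.
(* It remains to deal with the y-coordinate c of u = R'(y). The odd part of R(psi y) is b x' + c
   psi(y); R kills it and also x', hence c R(psi y) = 0. *)
have := Ru; rewrite uE psiy K3odd_linE => /(rota_baxter_K3odd n2 R_rb).
have -> : K3vec 0 (b * q + c * q') (b * r + c * r') =
          b *: K3vec 0 q r + c *: psi K3y.
  by rewrite psiy !K3vecZ K3vecD; congr K3vec; ring.
rewrite linearD !linearZ /= Rx' scaler0 add0r => /eqP.
(* Either c = 0, or R(psi y) = 0 and then R'(y) = 0. *)
rewrite scaler_eq0 => /orP[/eqP c0|/eqP Ry0].
  by exists a, b; rewrite c0 /K3vec scale0r addr0.
by exists 0, 0; rewrite !scale0r addr0 -uE -(psiK u) -Ru Ry0 linear0.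
Qed.
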